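(* Let $E,V,a,a_1,a_2,b>0$ and $\mathcal T>0$ be fixed constants, and put $\mu=\frac{a_2a^2b^4}{E^3}$ and $\lambda=\frac{a_1a^2E^2}{V}$. Then for all sufficiently large $B>0$ the equation $$\frac{B}{1-x_B}-\frac{2\mu}{x_B^3}+\lambda\,(2x_B-3x_B^2)=0$$ has a unique root $x_B\in(0,1)$, and the path $\mathbf x(t)\equiv x_B$, $\mathbf y(t)=Bt$, $t\in[0,\mathcal T]$, is a stationary emission regime. Moreover $x_B\to0$ as $B\to\infty$, with the asymptotics $$x_B\sim\frac{\sqrt[3]{2a_2a^2b^4}}{E}\,\frac{1}{\sqrt[3]{B}}\qquad (B\to\infty),$$ i.e. the ratio of the two sides tends to $1$.
   Context: Physical meaning of the constants (only positivity matters mathematically): $E$ is the total energy in a volume $V$, $a=2G/c^4$, $b=\hbar c/(4\pi a)$, $a_1=\pi c$, $a_2=4\pi\sigma$, where $G$ is the gravitational constant, $c$ the speed of light, $\hbar$ the reduced Planck constant and $\sigma$ the emission constant. Let $\mathbf C_1$ be the set of pairs of absolutely continuous functions $(\mathbf x,\mathbf y)$ on $[0,\mathcal T]$ with $\mathbf x(t)\in[0,1]$, $\mathbf y(t)\ge 0$ non-decreasing and $\mathbf y(0)=0$. Here $\mathbf x$ is the scaled number of quanta in the black hole and $\mathbf y$ the scaled number of emitted quanta. The Hamiltonian is $$H(x,y,\varkappa_1,\varkappa_2)=\lambda x^2(1-x)\,[e^{\varkappa_1}-1]+\frac{\mu}{x^2}\,[e^{-\varkappa_1+\varkappa_2}-1],$$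 and the rate function on $\mathbf C_1$ is $$I(\mathbf x,\mathbf y)=\int_0^{\mathcal T}\sup_{(\varkappa_1,\varkappa_2)\in\mathbb R^2}\bigl\{\varkappa_1\dot{\mathbf x}(t)+\varkappa_2\dot{\mathbf y}(t)-H(\mathbf x(t),\mathbf y(t),\varkappa_1,\varkappa_2)\bigr\}\,dt .$$ A path $(\mathbf x,\mathbf y)\in\mathbf C_1$ is an extremal of $I$ if it satisfies the Euler–Lagrange equations of $I$ in their Hamiltonian form, i.e. there exist differentiable functions $\boldsymbol\varkappa_1,\boldsymbol\varkappa_2:[0,\mathcal T]\to\mathbb R$ such that on $[0,\mathcal T]$ $$\begin{aligned} \dot{\mathbf x}&=\lambda\mathbf x^2(1-\mathbf x)e^{\boldsymbol\varkappa_1}-\frac{\mu}{\mathbf x^2}e^{-\boldsymbol\varkappa_1+\boldsymbol\varkappa_2},\\ \dot{\mathbf y}&=\frac{\mu}{\mathbf x^2}e^{-\boldsymbol\varkappa_1+\boldsymbol\varkappa_2},\\ \dot{\boldsymbol\varkappa}_1&=-\lambda(2\mathbf x-3\mathbf x^2)[e^{\boldsymbol\varkappa_1}-1]+\frac{2\mu}{\mathbf x^3}[e^{-\boldsymbol\varkappa_1+\boldsymbol\varkappa_2}-1],\\ \dot{\boldsymbol\varkappa}_2&=0. \end{aligned}$$ Definition (stationary emission regime). For a constant $B>0$, a path $(\mathbf x_B(t),\mathbf y_B(t))$, $t\in[0,\mathcal T]$, is called a stationary emission regime if: (1) there is a constant $x_B$ such that $\mathbf x_B(t)\equiv x_B$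 for $t\in[0,\mathcal T]$; (2) $\mathbf y_B(t)=Bt$ for $t\in[0,\mathcal T]$; (3) the path $(\mathbf x_B,\mathbf y_B)$ is an extremal of $I$ with the boundary conditions $\mathbf x_B(0)=\mathbf x_B(\mathcal T)=x_B$, $\mathbf y_B(0)=0$, $\mathbf y_B(\mathcal T)=B\mathcal T$. *)

(* Defs.v *)
From Stdlib Require Import Reals Lra.
From Coquelicot Require Import Coquelicot.
Open Scope R_scope.

Definition Icc (T t : R) : Prop := 0 <= t <= T.

(* The finite families are indexed by {0, ..., n}, hence nonempty; the empty
   family gives no condition. *)
Definition absolutely_continuous_on (T : R) (f : R -> R) : Prop :=
  forall eps, 0 < eps -> exists delta, 0 < delta /\
    forall (n : nat) (u v : nat -> R),
      (forall i, (i <= n)%nat -> 0 <= u i /\ u i < v i /\ v i <= T) ->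
      (forall i j, (i <= n)%nat -> (j <= n)%nat -> i <> j ->
         v i <= u j \/ v j <= u i) ->
      sum_f_R0 (fun i => v i - u i) n < delta ->
      sum_f_R0 (fun i => Rabs (f (v i) - f (u i))) n < eps.

(* A path on [0, T] is represented by total functions, of which only the values
   on [0, T] matter. *)
Definition C1_path (T : R) (x y : R -> R) : Prop :=
  absolutely_continuous_on T x /\
  absolutely_continuous_on T y /\
  (forall t, Icc T t -> 0 <= x t <= 1) /\
  (forall t, Icc T t -> 0 <= y t) /\
  (forall s t, Icc T s -> Icc T t -> s <= t -> y s <= y t) /\
  y 0 = 0.

Definition hamiltonian (lam mu x y k1 k2 : R) : R :=
  lam * x ^ 2 * (1 - x) * (exp k1 - 1) + mu / x ^ 2 * (exp (- k1 + k2) - 1).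

(* Derivatives are taken within [0, T], so they are one-sided at the end
   points. The condition [x t <> 0] makes the right-hand sides meaningful, since
   division by 0 is total here. *)
Definition extremal (lam mu T : R) (x y : R -> R) : Prop :=
  C1_path T x y /\
  (forall t, Icc T t -> x t <> 0) /\
  exists k1 k2 : R -> R, forall t, Icc T t ->
    D_in x (fun s => lam * x s ^ 2 * (1 - x s) * exp (k1 s)
                     - mu / x s ^ 2 * exp (- k1 s + k2 s)) (Icc T) t /\
    D_in y (fun s => mu / x s ^ 2 * exp (- k1 s + k2 s)) (Icc T) t /\
    D_in k1 (fun s => - lam * (2 * x s - 3 * x s ^ 2) * (exp (k1 s) - 1)
                      + 2 * mu / x s ^ 3 * (exp (- k1 s + k2 s) - 1))
         (Icc T) t /\
    D_in k2 (fun _ => 0) (Icc T) t.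

(* The right-hand sides in [extremal] are dH/dk1, dH/dk2, -dH/dx and -dH/dy. *)
Lemma hamiltonian_partials (lam mu x y k1 k2 : R) : x <> 0 ->
  is_derive (fun k => hamiltonian lam mu x y k k2) k1
    (lam * x ^ 2 * (1 - x) * exp k1 - mu / x ^ 2 * exp (- k1 + k2)) /\
  is_derive (fun k => hamiltonian lam mu x y k1 k) k2
    (mu / x ^ 2 * exp (- k1 + k2)) /\
  is_derive (fun z => - hamiltonian lam mu z y k1 k2) x
    (- lam * (2 * x - 3 * x ^ 2) * (exp k1 - 1)
     + 2 * mu / x ^ 3 * (exp (- k1 + k2) - 1)) /\
  is_derive (fun z => - hamiltonian lam mu x z k1 k2) y 0.
Proof.
intros hx; unfold hamiltonian.
split; [|split; [|split]]; auto_derive; trivial; try (field; exact hx).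
repeat apply Rmult_integral_contrapositive_currified; lra.
Qed.

Definition stationary_emission_regime (lam mu T B : R) (x y : R -> R) : Prop :=
  0 < B /\
  exists xB : R,
    (forall t, Icc T t -> x t = xB) /\
    (forall t, Icc T t -> y t = B * t) /\
    extremal lam mu T x y /\
    x 0 = xB /\ x T = xB /\ y 0 = 0 /\ y T = B * T.

Definition stationary_equation (lam mu B x : R) : Prop :=
  B / (1 - x) - 2 * mu / x ^ 3 + lam * (2 * x - 3 * x ^ 2) = 0.

(* Main.v *)
Require Import Defs.
From Stdlib Require Import Reals Lra.
From Coquelicot Require Import Coquelicot.
Open Scope R_scope.

(** For a constant path [x = xB], [y = B t], the equations for [x] and [y]
    prescribe the two jump intensities: both [lam x^2 (1-x) e^k1] and
    [mu / x^2 e^(-k1+k2)] equal [B].  This determines constants [k1] and [k2],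
    and the one condition left, that [k1' = 0], becomes the stationary equation
    once the exponentials are eliminated
    ([stationary_root_gives_emission_regime]).

    After multiplication by [x^3 (1-x)] the equation is polynomial,
    [B x^3 = 2 mu (1-x) - lam x^4 (2-3x) (1-x)], and the difference of the two
    sides changes sign on [[0,1]], whence a root ([stationary_root]).  In its
    original form the left-hand side has derivative
    [B/(1-x)^2 + 6 mu/x^4 + lam (2-6x) > B - 4 lam], so for [B >= 4 lam] it is
    increasing and the root is unique ([stationary_root_unique]).

    The polynomial form also gives the asymptotics.  Its right-hand side is
    bounded, so [x_B^3 = O(1/B)] and [x_B -> 0] ([stationary_root_vanishes]).
    Dividing by [2 mu], the cube of the ratio [r = x_B / (2 mu / B)^(1/3)] is a
    continuous function of [x_B] with value [1] at [0]; so [r^3 -> 1], and then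
    [r -> 1] because [|r - 1| <= |r^3 - 1|] for [r >= 0]
    ([cube_ratio_limit]). *)

(** * Roots of the stationary equation *)

(** The stationary equation with its denominators cleared, hence meaningful and
    continuous on all of [[0,1]]. *)
Definition cleared (lam mu B x : R) : R :=
  B * x ^ 3 - 2 * mu * (1 - x) + lam * x ^ 4 * (2 - 3 * x) * (1 - x).

Lemma stationary_equation_cleared (lam mu B x : R) : 0 < x < 1 ->
  stationary_equation lam mu B x <-> cleared lam mu B x = 0.
Proof.
intros [hx0 hx1]; unfold stationary_equation, cleared.
assert (hd : x ^ 3 * (1 - x) <> 0).
{ apply Rgt_not_eq, Rmult_lt_0_compat; [apply pow_lt|]; lra. }
assert (heq : B * x ^ 3 - 2 * mu * (1 - x) + lam * x ^ 4 * (2 - 3 * x) * (1 - x)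
  = x ^ 3 * (1 - x)
    * (B / (1 - x) - 2 * mu / x ^ 3 + lam * (2 * x - 3 * x ^ 2))).
{ field; lra. }
rewrite heq; split; intros h.
- rewrite h; ring.
- destruct (Rmult_integral _ _ h); [contradiction|assumption].
Qed.

(** The cleared form is [- 2 mu < 0] at [0] and [B > 0] at [1].  The result is
    informative so that it yields a root as a function of [B]. *)
Lemma stationary_root (lam mu B : R) : 0 < mu -> 0 < B ->
  {x : R | 0 < x < 1 /\ stationary_equation lam mu B x}.
Proof.
intros hmu hB.
assert (h0 : cleared lam mu B 0 = - (2 * mu)) by (unfold cleared; ring).
assert (h1 : cleared lam mu B 1 = B) by (unfold cleared; ring).
destruct (IVT (cleared lam mu B) 0 1) as [x [hx hroot]]; try lra.
{ unfold cleared; reg. }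
assert (h01 : 0 < x < 1).
{ split; [destruct (Req_dec x 0) | destruct (Req_dec x 1)]; subst; lra. }
exists x; split; [exact h01|].
apply stationary_equation_cleared; assumption.
Qed.

Lemma stationary_root_function (lam mu : R) : 0 < mu ->
  exists xB : R -> R, forall B, 0 < B ->
    0 < xB B < 1 /\ stationary_equation lam mu B (xB B).
Proof.
intros hmu.
exists (fun B => match Rlt_dec 0 B with
                 | left hB => proj1_sig (stationary_root lam mu B hmu hB)
                 | right _ => 0
                 end).
intros B hB; destruct (Rlt_dec 0 B) as [h|]; [|contradiction].
exact (proj2_sig (stationary_root lam mu B hmu h)).
Qed.

(** The slope of the first term is at least [B], the second term increases, and
    the slope of the last exceeds [- 4 lam]. *)
Lemma stationary_lhs_increasing (lam mu B x y : R) :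
  0 < lam -> 0 < mu -> 4 * lam <= B -> 0 < x -> x < y -> y < 1 ->
  B / (1 - x) - 2 * mu / x ^ 3 + lam * (2 * x - 3 * x ^ 2)
  < B / (1 - y) - 2 * mu / y ^ 3 + lam * (2 * y - 3 * y ^ 2).
Proof.
intros hlam hmu hB hx hxy hy.
assert (hfirst : B / (1 - x) + B * (y - x) <= B / (1 - y)).
{ assert (hp : 0 < (1 - x) * (1 - y) <= 1) by (split; nra).
  assert (hinv : 1 <= / ((1 - x) * (1 - y))).
  { rewrite <- Rinv_1; apply Rinv_le_contravar; lra. }
  replace (B / (1 - y))
    with (B / (1 - x) + B * (y - x) * / ((1 - x) * (1 - y))) by (field; lra).
  assert (hBd : 0 < B * (y - x)) by (apply Rmult_lt_0_compat; lra).
  nra. }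
assert (hsecond : 2 * mu / y ^ 3 <= 2 * mu / x ^ 3).
{ apply Rmult_le_compat_l; [lra|].
  apply Rinv_le_contravar; [apply pow_lt | apply pow_incr]; lra. }
assert (hthird : 0 < lam * (y - x) * (6 - 3 * (x + y))).
{ repeat apply Rmult_lt_0_compat; lra. }
nra.
Qed.

Lemma stationary_root_unique (lam mu B x y : R) :
  0 < lam -> 0 < mu -> 4 * lam <= B -> 0 < x < 1 -> 0 < y < 1 ->
  stationary_equation lam mu B x -> stationary_equation lam mu B y -> x = y.
Proof.
unfold stationary_equation; intros hlam hmu hB hx hy ex ey.
destruct (Rtotal_order x y) as [h|[h|h]]; [|exact h|];
  [pose proof (stationary_lhs_increasing lam mu B x y) |
   pose proof (stationary_lhs_increasing lam mu B y x)]; lra.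
Qed.

(** * The stationary path is an extremal *)

Lemma lipschitz_absolutely_continuous (T L : R) (f : R -> R) : 0 <= L ->
  (forall s t, 0 <= s -> s < t -> t <= T ->
     Rabs (f t - f s) <= L * (t - s)) ->
  absolutely_continuous_on T f.
Proof.
intros hL hf eps heps.
exists (eps / (L + 1)); split; [apply Rdiv_lt_0_compat; lra|].
intros n u v huv _ hsum.
apply Rle_lt_trans with (sum_f_R0 (fun i => (v i - u i) * L) n).
{ apply sum_Rle; intros i hi.
  rewrite Rmult_comm.
  apply hf; destruct (huv i hi) as [? [? ?]]; assumption. }
rewrite <- scal_sum.
apply Rle_lt_trans with (L * (eps / (L + 1))).
{ apply Rmult_le_compat_l; lra. }
replace eps with ((L + 1) * (eps / (L + 1))) at 2 by (field; lra).
apply Rmult_lt_compat_r; [apply Rdiv_lt_0_compat|]; lra.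
Qed.

Lemma stationary_path_C1 (T B x : R) : 0 < B -> 0 <= x <= 1 ->
  C1_path T (fun _ => x) (fun t => B * t).
Proof.
intros hB hx; unfold C1_path, Icc.
split; [|split; [|split; [|split; [|split]]]].
- apply lipschitz_absolutely_continuous with 0; [lra|]; intros.
  rewrite Rminus_diag, Rabs_R0; lra.
- apply lipschitz_absolutely_continuous with B; [lra|]; intros s t _ hst _.
  rewrite Rabs_right; nra.
- intros; exact hx.
- intros; nra.
- intros; nra.
- ring.
Qed.

Lemma D_in_const (D : R -> Prop) (c t : R) (d : R -> R) :
  d t = 0 -> D_in (fun _ => c) d D t.
Proof.
intros hd; apply D_in_ext with (fun _ => 0); [symmetry; exact hd|].
apply Dconst.
Qed.

Lemma D_in_linear (D : R -> Prop) (c t : R) (d : R -> R) :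
  d t = c -> D_in (fun s => c * s) d D t.
Proof.
intros hd; apply D_in_ext with (fun _ => c * 1); [lra|].
apply (Dmult_const D (fun s => s) (fun _ => 1)), Dx.
Qed.

(** The momenta are the constants for which quanta are absorbed and emitted at
    the common rate [B]; the stationary equation then says [k1' = 0]. *)
Lemma stationary_root_gives_emission_regime (lam mu T B x : R) :
  0 < lam -> 0 < mu -> 0 < B -> 0 < x < 1 ->
  stationary_equation lam mu B x ->
  stationary_emission_regime lam mu T B (fun _ => x) (fun t => B * t).
Proof.
intros hlam hmu hB hx heq; split; [exact hB|].
exists x; split; [reflexivity|split; [reflexivity|split]];
  [|repeat split; ring].
split; [apply stationary_path_C1; lra|split; [intros; lra|]].
assert (hx2 : 0 < x ^ 2) by (apply pow_lt; lra).
set (absorb := B / (lam * x ^ 2 * (1 - x))).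
set (emit := B * x ^ 2 / mu).
assert (habs : 0 < absorb).
{ apply Rdiv_lt_0_compat; [lra|].
  repeat apply Rmult_lt_0_compat; lra. }
assert (hemit : 0 < emit).
{ apply Rdiv_lt_0_compat; [apply Rmult_lt_0_compat|]; lra. }
assert (e1 : exp (ln absorb) = absorb) by (apply exp_ln; exact habs).
assert (e2 : exp (- ln absorb + (ln absorb + ln emit)) = emit).
{ replace (- ln absorb + (ln absorb + ln emit)) with (ln emit) by ring.
  apply exp_ln; exact hemit. }
exists (fun _ => ln absorb), (fun _ => ln absorb + ln emit); intros t _.
split; [|split; [|split]].
- apply D_in_const; rewrite e1, e2; unfold absorb, emit; field; lra.
- apply D_in_linear; rewrite e2; unfold emit; field; lra.
- apply D_in_const; rewrite e1, e2, <- heq; unfold absorb, emit; field; lra.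
- apply D_in_const; reflexivity.
Qed.

(** * Asymptotics of the root *)

Lemma stationary_root_cube_bound (lam mu B x : R) :
  0 < lam -> 0 < mu -> 0 < x < 1 ->
  stationary_equation lam mu B x -> B * x ^ 3 <= 2 * mu + lam.
Proof.
intros hlam hmu hx heq.
apply stationary_equation_cleared in heq; [|exact hx].
unfold cleared in heq.
assert (hx4 : 0 < x ^ 4 <= 1).
{ split; [apply pow_lt; lra|].
  rewrite <- (pow1 4); apply pow_incr; lra. }
(* [(2-3x)(1-x)] is smallest at [x = 5/6], where it is [-1/12]. *)
assert (hq : - 1 <= (2 - 3 * x) * (1 - x)) by nra.
assert (hxq : - 1 <= x ^ 4 * ((2 - 3 * x) * (1 - x))) by nra.
nra.
Qed.

Lemma stationary_root_vanishes (lam mu : R) (xB : R -> R) :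
  0 < lam -> 0 < mu ->
  (forall B, 0 < B -> 0 < xB B < 1 /\ stationary_equation lam mu B (xB B)) ->
  is_lim xB p_infty 0.
Proof.
intros hlam hmu hxB; apply is_lim_spec; intros eps.
pose proof (cond_pos eps) as heps.
assert (heps3 : 0 < eps ^ 3) by (apply pow_lt; lra).
assert (hM : 0 < (2 * mu + lam) / eps ^ 3) by (apply Rdiv_lt_0_compat; lra).
exists ((2 * mu + lam) / eps ^ 3); intros B hB.
destruct (hxB B) as [hx heq]; [lra|].
pose proof (stationary_root_cube_bound lam mu B (xB B) hlam hmu hx heq).
rewrite Rminus_0_r, Rabs_right; [|lra].
apply Rnot_le_lt; intros hle.
assert (hcube : eps ^ 3 <= xB B ^ 3) by (apply pow_incr; lra).
assert (hB3 : 2 * mu + lam < B * eps ^ 3).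
{ replace (2 * mu + lam) with ((2 * mu + lam) / eps ^ 3 * eps ^ 3)
    by (field; lra).
  apply Rmult_lt_compat_r; lra. }
nra.
Qed.

Lemma cube_dist_1 (r : R) : 0 <= r -> Rabs (r - 1) <= Rabs (r ^ 3 - 1).
Proof.
intros hr.
replace (r ^ 3 - 1) with ((r - 1) * (r ^ 2 + r + 1)) by ring.
rewrite Rabs_mult, (Rabs_right (r ^ 2 + r + 1)) by nra.
pose proof (Rabs_pos (r - 1)); nra.
Qed.

Lemma cube_ratio_limit (r : R -> R) (g : R -> R) (M : R) :
  (forall B, M < B -> 0 <= r B /\ r B ^ 3 = g B) ->
  is_lim g p_infty 1 -> is_lim r p_infty 1.
Proof.
intros hr hg; apply is_lim_spec; intros eps.
apply is_lim_spec in hg; destruct (hg eps) as [N hN].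
exists (Rmax M N); intros B hB.
pose proof (Rmax_l M N); pose proof (Rmax_r M N).
destruct (hr B) as [hpos hcube]; [lra|].
apply Rle_lt_trans with (Rabs (r B ^ 3 - 1)).
- apply cube_dist_1; exact hpos.
- rewrite hcube; apply hN; lra.
Qed.

Lemma Rpower_third_cube (z : R) : 0 < z -> Rpower z (1 / 3) ^ 3 = z.
Proof.
intros hz; rewrite <- Rpower_pow by apply exp_pos.
rewrite Rpower_mult.
replace (1 / 3 * INR 3) with 1 by (simpl; field).
apply Rpower_1; exact hz.
Qed.

(** With [c ^ 3 = 2 mu], the equation for the root reads
    [(x_B / (c / B^(1/3)))^3 = (1 - x_B) (1 - lam x_B^4 (2 - 3 x_B) / (2 mu))]. *)
Lemma stationary_root_asymptotics (lam mu c : R) (xB : R -> R) :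
  0 < lam -> 0 < mu -> 0 < c -> c ^ 3 = 2 * mu ->
  (forall B, 0 < B -> 0 < xB B < 1 /\ stationary_equation lam mu B (xB B)) ->
  is_lim (fun B => xB B / (c * (1 / Rpower B (1 / 3)))) p_infty 1.
Proof.
intros hlam hmu hc hc3 hxB.
set (h x := (1 - x) * (1 - lam * x ^ 4 * (2 - 3 * x) / (2 * mu))).
apply cube_ratio_limit with (g := fun B => h (xB B)) (M := 0).
- intros B hB.
  destruct (hxB B hB) as [hx heq].
  apply stationary_equation_cleared in heq; [|exact hx].
  unfold cleared in heq.
  pose proof (Rpower_third_cube B hB) as hs.
  assert (hspos : 0 < Rpower B (1 / 3)) by apply exp_pos.
  set (s := Rpower B (1 / 3)) in *; clearbody s.
  replace (xB B / (c * (1 / s))) with (xB B * s / c) by (field; lra).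
  split.
  { apply Rlt_le, Rdiv_lt_0_compat; nra. }
  replace ((xB B * s / c) ^ 3) with (s ^ 3 * xB B ^ 3 / c ^ 3) by (field; lra).
  rewrite hs, hc3; unfold h.
  replace (B * xB B ^ 3)
    with (2 * mu * (1 - xB B)
          - lam * xB B ^ 4 * (2 - 3 * xB B) * (1 - xB B)) by lra.
  field; lra.
- replace 1 with (h 0) by (unfold h; field; lra).
  apply (is_lim_comp_continuous xB h).
  + apply stationary_root_vanishes with lam mu; assumption.
  + apply (ex_derive_continuous h); unfold h; auto_derive; lra.
Qed.

Theorem theorem4p2 (E V a a1 a2 b T : R)
  (hE : 0 < E) (hV : 0 < V) (ha : 0 < a) (ha1 : 0 < a1) (ha2 : 0 < a2)
  (hb : 0 < b) (hT : 0 < T) :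
  let mu := a2 * a ^ 2 * b ^ 4 / E ^ 3 in
  let lam := a1 * a ^ 2 * E ^ 2 / V in
  exists (B0 : R) (xB : R -> R),
    0 < B0 /\
    (forall B, B0 < B ->
       unique (fun x => 0 < x < 1 /\ stationary_equation lam mu B x) (xB B) /\
       stationary_emission_regime lam mu T B (fun _ => xB B) (fun t => B * t)) /\
    is_lim xB p_infty 0 /\
    is_lim (fun B => xB B /
              (Rpower (2 * a2 * a ^ 2 * b ^ 4) (1 / 3) / E
               * (1 / Rpower B (1 / 3)))) p_infty 1.
Proof.
intros mu lam.
assert (hnum : 0 < a2 * a ^ 2 * b ^ 4).
{ repeat apply Rmult_lt_0_compat; lra. }
assert (hmu : 0 < mu).
{ apply Rdiv_lt_0_compat; [|apply pow_lt]; assumption. }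
assert (hlam : 0 < lam).
{ apply Rdiv_lt_0_compat; [|assumption].
  repeat apply Rmult_lt_0_compat; lra. }
destruct (stationary_root_function lam mu hmu) as [xB hxB].
exists (4 * lam), xB; split; [lra|split; [|split]].
- intros B hB.
  destruct (hxB B) as [hx heq]; [lra|].
  split.
  + split; [split; assumption|].
    intros y [hy heqy].
    apply stationary_root_unique with lam mu B; assumption || lra.
  + apply stationary_root_gives_emission_regime; assumption || lra.
- apply stationary_root_vanishes with lam mu; assumption.
- apply stationary_root_asymptotics with lam mu; try assumption.
  + apply Rdiv_lt_0_compat; [apply exp_pos | exact hE].
  + unfold Rdiv at 1; rewrite Rpow_mult_distr, Rpower_third_cube by lra.
    unfold mu; field; lra.
Qed.
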